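(* As $x\to\infty$, $$\sum_{r\le x}N_3(0,r)=\frac{24\,\zeta(3)}{\pi^4}\,x^3+O(x^2\log x).$$
   Context: For $r\in\mathbb{N}=\{1,2,\ldots\}$, $N_3(0,r)$ is the number of solutions $(x,y,z)\in(\mathbb{Z}/r\mathbb{Z})^3$ of $x^2+y^2+z^2\equiv 0\pmod r$. The sum runs over all positive integers $r\le x$. $\zeta$ is the Riemann zeta function. *)

(* Defs.v *)
From HB Require Import structures.
From mathcomp Require Import all_boot all_order all_algebra.
From mathcomp Require Import all_classical all_reals all_analysis.
Set Implicit Arguments.
Unset Strict Implicit.
Unset Printing Implicit Defensive.
Import Order.TTheory GRing.Theory Num.Theory numFieldNormedType.Exports.
Local Open Scope ring_scope.

(* Residue classes mod r are represented by 'I_r rather than 'Z_r, because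
   'Z_1 is Z/2Z in MathComp; for every r >= 1, 'I_r has exactly r elements. *)
Definition N3 (a r : nat) : nat :=
  #|[set t : 'I_r * 'I_r * 'I_r |
      (t.1.1 ^ 2 + t.1.2 ^ 2 + t.2 ^ 2 == a %[mod r])%N]|.

(* The Riemann zeta function on its half-line of convergence: only the values
   at s > 1 are meaningful. *)
Definition zeta (R : realType) (s : R) : R :=
  limn (series (fun n : nat => (n.+1%:R : R) `^ (- s))).

(* The library packs the filters at points of a space for use in Landau
   notations, but not the filter at +oo. *)
Canonical pinfty_filter_on (R : numFieldType) :=
  FilterType (pinfty_nbhs R) _.

(* Main.v *)
(* Counting solutions modulo prime powers (Hensel lifting for odd p, infinite
   descent for p = 2) gives the Dirichlet series
     sum_r N3(0,r) r^-s =
       zeta(s-2) zeta(2s-3) / zeta(2s-2) * (1 - 16 4^-s) / (1 - 4 4^-s),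
   that is, N3(0,r) = sum_(d^2 | r) w(d) (r/d)^2, where w(d) is phi(d) for odd d
   and -2 phi(d) for even d.  Summing the squares over the multiples of d^2 gives
   x^3/3 * sum_(d <= x) w(d)/d^4 up to O(x^2 sum_(d <= x) 1/d).  The limit of
   sum w(d)/d^4 comes from the convolution identity
   sum_(d | n, n/d odd) w(d) = +-n (sign + iff n is odd): multiplied by
   sum_(e odd) e^-4 = pi^4/96, the series equals
   sum_n (-1)^(n-1) n^-3 = 3/4 zeta(3). *)
Require Import Defs.
From mathcomp Require Import all_boot all_order all_algebra.
From mathcomp Require Import all_classical all_reals all_analysis.
From mathcomp Require Import cyclic zify ring lra.
Import Order.TTheory GRing.Theory Num.Theory numFieldNormedType.Exports.
Local Open Scope ring_scope.

(** * Counting solutions modulo prime powers *)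

Section Counting.
Local Open Scope nat_scope.

Lemma reindex_ord_mod p (h : nat -> nat) (F : nat -> nat) : 0 < p ->
    {in [pred i | i < p] &, forall i j, h i = h j %[mod p] -> i = j} ->
  \sum_(i < p) F (h i %% p) = \sum_(i < p) F i.
Proof.
move=> p0 hI; pose k (i : 'I_p) := Ordinal (ltn_pmod (h i) p0).
rewrite [RHS](reindex_inj (h := k)) // => i j [] /hI E.
by apply: val_inj; apply: E; rewrite inE.
Qed.

(** By the Chinese remainder theorem [x] is determined by its two residues; equal cardinalities then
    give a bijection. *)
Lemma sum_coprime_mul a b (F G : nat -> nat) : 0 < a -> 0 < b -> coprime a b ->
  \sum_(x < a * b) F (x %% a) * G (x %% b) =
  (\sum_(u < a) F u) * (\sum_(v < b) G v).
Proof.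
move=> a0 b0 cab; rewrite big_distrlr /= pair_bigA /=.
pose h (x : 'I_(a * b)) :=
  (Ordinal (ltn_pmod x a0), Ordinal (ltn_pmod x b0)).
rewrite [RHS](reindex h) //; apply: onW_bij; apply: inj_card_bij.
  move=> x y [Ea Eb]; apply: val_inj; have := chinese_remainder cab x y.
  by rewrite Ea Eb !eqxx => /eqP; rewrite !modn_small.
by rewrite card_prod !card_ord.
Qed.

(** Writing [x = u + m * a] groups the residues modulo [m * p] as lifts of residues modulo [m]. *)
Lemma sum_ord_mul m p (F : nat -> nat) :
  \sum_(x < m * p) F x = \sum_(u < m) \sum_(a < p) F (u + m * a).
Proof.
rewrite exchange_big /=; elim: p => [|p IH]; first by rewrite muln0 !big_ord0.
rewrite big_ord_recr -IH mulnSr big_split_ord /=; congr addn.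
by apply: eq_bigr => u _; rewrite addnC.
Qed.

(** As [t] is invertible modulo [p], [s + t * a] runs through all residues and vanishes once. *)
Lemma sum_dvdn_linear p s t : prime p -> ~~ (p %| t) ->
  \sum_(a < p) (p %| s + t * a) = 1.
Proof.
move=> pp pt; have p0 := prime_gt0 pp.
transitivity (\sum_(a < p) ((s + t * a) %% p == 0)); first by [].
rewrite (reindex_ord_mod p (fun a => s + t * a) (fun c => nat_of_bool (c == 0))) //.
  case: p pp {pt p0} => // p _; rewrite big_ord_recl /= big1 // => i _.
move=> i j; rewrite !inE => ip jp /eqP; rewrite eqn_modDl.
wlog le_ij : i j ip jp / i <= j => [W|].
  case/orP: (leq_total i j) => [|ji E]; first exact: W.
  by apply/esym; apply: W => //; rewrite eq_sym.
rewrite eq_sym eqn_mod_dvd ?leq_mul2l ?le_ij ?orbT // -mulnBr Euclid_dvdM // (negbTE pt) /=.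
move=> /dvdnP [k E]; have : j - i < p by lia.
case: k E => [|k]; nia.
Qed.

(** Counts of triples are sums of booleans, so that linearity and reindexing apply to them. *)
Definition sum3 n (F : nat -> nat -> nat -> nat) :=
  \sum_(x < n) \sum_(y < n) \sum_(z < n) F x y z.

Lemma eq_sum3 n F G :
  (forall x y z, x < n -> y < n -> z < n -> F x y z = G x y z) -> sum3 n F = sum3 n G.
Proof. by move=> E; do 3![apply: eq_bigr => ? _]; apply: E. Qed.

Lemma sum3D n F G : sum3 n (fun x y z => F x y z + G x y z) = sum3 n F + sum3 n G.
Proof. by rewrite /sum3 -big_split /=; do 2![apply: eq_bigr => ? _; rewrite -big_split /=]. Qed.

Lemma sum3Zl c n F : sum3 n (fun x y z => c * F x y z) = c * sum3 n F.
Proof. by rewrite /sum3 big_distrr /=; do 2![apply: eq_bigr => ? _; rewrite big_distrr /=]. Qed.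

Lemma sum3_const n c : sum3 n (fun _ _ _ => c) = n ^ 3 * c.
Proof. by rewrite /sum3 !big_const_ord !iter_addn_0; lia. Qed.

Lemma sum3_mul m p F :
  sum3 (m * p) F =
  sum3 m (fun u v w => sum3 p (fun a b c => F (u + m * a) (v + m * b) (w + m * c))).
Proof.
rewrite /sum3 (sum_ord_mul m p (fun x => \sum_(y < m * p) \sum_(z < m * p) F x y z)).
apply: eq_bigr => u _.
transitivity (\sum_(a < p) \sum_(v < m) \sum_(b < p) \sum_(w < m) \sum_(c < p)
    F (u + m * a) (v + m * b) (w + m * c)).
  apply: eq_bigr => a _.
  rewrite (sum_ord_mul m p (fun y => \sum_(z < m * p) F (u + m * a) y z)).
  apply: eq_bigr => v _; apply: eq_bigr => b _.
  exact: (sum_ord_mul m p (F (u + m * a) (v + m * b))).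
rewrite exchange_big; apply: eq_bigr => v _ /=.
rewrite [RHS]exchange_big; apply: eq_bigr => a _ /=.
by rewrite exchange_big.
Qed.

Lemma sum3_eq0 n F : (forall x y z, x < n -> y < n -> z < n -> F x y z = 0) -> sum3 n F = 0.
Proof. by move=> /eq_sum3 ->; rewrite sum3_const muln0. Qed.

Lemma sum3_at0 n F : 0 < n ->
    (forall x y z, x < n -> y < n -> z < n -> (x, y, z) != (0, 0, 0) -> F x y z = 0) ->
  sum3 n F = F 0 0 0.
Proof.
case: n => // n _ F0; rewrite /sum3 big_ord_recl [X in _ + X]big1 ?addn0 => [|x _].
  rewrite big_ord_recl [X in _ + X]big1 ?addn0 => [|y _].
    rewrite big_ord_recl [X in _ + X]big1 ?addn0 => [//|z _].
    by rewrite F0.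
  by rewrite big1 // => z _; rewrite F0.
by rewrite big1 // => y _; rewrite big1 // => z _; rewrite F0.
Qed.

(** One coefficient is invertible modulo [p]: the other two variables are free and determine the
    third. *)
Lemma sum3_linear p s t1 t2 t3 : prime p -> ~~ [&& p %| t1, p %| t2 & p %| t3] ->
  sum3 p (fun a b c => p %| s + (t1 * a + t2 * b + t3 * c)) = p ^ 2.
Proof.
move=> pp; rewrite /sum3 -mulnn.
have C n : \sum_(a < p) n = p * n by rewrite big_const_ord iter_addn_0 mulnC.
have L r t : ~~ (p %| t) -> \sum_(a < p) (p %| r + t * a) = 1 by apply: sum_dvdn_linear.
rewrite !negb_and => /or3P[] nd.
- rewrite exchange_big /=; under eq_bigr => b _ do rewrite exchange_big /=.
  transitivity (\sum_(c < p) \sum_(b < p) 1); last by rewrite !C muln1.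
  apply: eq_bigr => c _; apply: eq_bigr => b _; rewrite -[RHS](L (s + (t2 * c + t3 * b)) t1) //.
  by apply: eq_bigr => a _; congr (nat_of_bool (_ %| _)); lia.
- under eq_bigr => a _ do rewrite exchange_big /=.
  transitivity (\sum_(c < p) \sum_(b < p) 1); last by rewrite !C muln1.
  apply: eq_bigr => c _; apply: eq_bigr => b _; rewrite -[RHS](L (s + (t1 * c + t3 * b)) t2) //.
  by apply: eq_bigr => a _; congr (nat_of_bool (_ %| _)); lia.
- transitivity (\sum_(c < p) \sum_(b < p) 1); last by rewrite !C muln1.
  apply: eq_bigr => c _; apply: eq_bigr => b _; rewrite -[RHS](L (s + (t1 * c + t2 * b)) t3) //.
  by apply: eq_bigr => a _; congr (nat_of_bool (_ %| _)); lia.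
Qed.

(** * Solutions modulo prime powers: lifting and descent *)

Definition nsol r :=
  sum3 r (fun x y z => r %| x ^ 2 + y ^ 2 + z ^ 2).

Lemma dvdn_sq3_mod d x y z u v w :
    x = u %[mod d] -> y = v %[mod d] -> z = w %[mod d] ->
  (d %| x ^ 2 + y ^ 2 + z ^ 2) = (d %| u ^ 2 + v ^ 2 + w ^ 2).
Proof.
move=> xu yv zw; rewrite /dvdn; congr (_ == _).
have E s t : s = t %[mod d] -> s ^ 2 = t ^ 2 %[mod d].
  by move=> st; rewrite -modnXm st modnXm.
have D s t s' t' : s = t %[mod d] -> s' = t' %[mod d] -> s + s' = t + t' %[mod d].
  by move=> st st'; rewrite -modnDm st st' modnDm.
by apply: (D); [apply: D|]; apply: E.
Qed.

(** The Chinese remainder theorem is applied to the three variables in turn. *)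
Lemma nsolM a b : 0 < a -> 0 < b -> coprime a b -> nsol (a * b) = nsol a * nsol b.
Proof.
move=> a0 b0 cab.
pose S d x y z : nat := d %| x ^ 2 + y ^ 2 + z ^ 2.
have ES x y z : (a * b %| x ^ 2 + y ^ 2 + z ^ 2) =
    S a (x %% a) (y %% a) (z %% a) * S b (x %% b) (y %% b) (z %% b) :> nat.
  rewrite Gauss_dvd // /S mulnb; congr (nat_of_bool (_ && _));
  by apply: dvdn_sq3_mod; rewrite modn_mod.
transitivity (\sum_(x < a * b)
    (\sum_(y < a) \sum_(z < a) S a (x %% a) y z) *
    (\sum_(y < b) \sum_(z < b) S b (x %% b) y z)); last first.
  exact: (sum_coprime_mul a b (fun x => \sum_(y < a) \sum_(z < a) S a x y z)
                              (fun x => \sum_(y < b) \sum_(z < b) S b x y z)).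
apply: eq_bigr => x _.
rewrite -(sum_coprime_mul a b (fun y => \sum_(z < a) S a (x %% a) y z)
                              (fun y => \sum_(z < b) S b (x %% b) y z)) //.
apply: eq_bigr => y _.
rewrite -(sum_coprime_mul a b (S a (x %% a) (y %% a)) (S b (x %% b) (y %% b))) //.
by apply: eq_bigr => z _; rewrite ES.
Qed.

(** Primitive solutions: some coordinate is not divisible by [p]. *)
Definition nsol_prim p k :=
  sum3 (p ^ k) (fun x y z =>
    ~~ [&& p %| x, p %| y & p %| z] && (p ^ k %| x ^ 2 + y ^ 2 + z ^ 2)).

(** Hensel lifting: adding [q * (a, b, c)] to [(u, v, w)] changes the form by
    [2 q (u a + v b + w c)] modulo [p q]. Lifting is thus a linear condition on [(a, b, c)] modulo
    [p], nondegenerate because [p] is odd. *)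
Lemma nsol_prim_lift p k : prime p -> odd p -> nsol_prim p k.+2 = p ^ 2 * nsol_prim p k.+1.
Proof.
move=> pp op; rewrite /nsol_prim; set q := p ^ k.+1.
have q0 : 0 < q by rewrite expn_gt0 prime_gt0.
have pq : p %| q by rewrite /q expnS dvdn_mulr.
have pqD u a : (p %| u + q * a) = (p %| u) by rewrite dvdn_addl // dvdn_mulr.
rewrite [p ^ k.+2]expnSr -/q sum3_mul -sum3Zl; apply: eq_sum3 => u v w _ _ _.
have [|nd] := boolP [&& p %| u, p %| v & p %| w].
  by move=> d; rewrite muln0; apply: sum3_eq0 => a b c _ _ _; rewrite !pqD d.
have [|nS] := boolP (q %| u ^ 2 + v ^ 2 + w ^ 2); last first.
  rewrite muln0; apply: sum3_eq0 => a b c _ _ _; rewrite !pqD nd /=.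
  apply/eqP; rewrite eqb0; apply: contra nS => /(dvdn_trans (dvdn_mulr p (dvdnn q))).
  by congr is_true; apply: dvdn_sq3_mod; rewrite addnC mulnC modnMDl.
case/dvdnP => s Es; rewrite muln1 -(sum3_linear p s (2 * u) (2 * v) (2 * w)) //; last first.
  by rewrite !Euclid_dvdM // dvdn_prime2 // (_ : (p == 2) = false) //; case: eqP op => // ->.
apply: eq_sum3 => a b c _ _ _; rewrite !pqD nd /=; congr nat_of_bool.
(* Adding a multiple of [q], which [p] divides, supplies the quadratic terms of the expansion. *)
rewrite -[RHS](pqD _ (a ^ 2 + b ^ 2 + c ^ 2)) -[RHS](dvdn_pmul2l q0).
congr (_ %| _); rewrite !mulnDr (mulnC q s) -Es; ring.
Qed.

(** Squares are 0 or 1 modulo 4, so three squares with sum divisible by 4 are all even. *)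
Lemma nsol_prim2_eq0 k : nsol_prim 2 k.+2 = 0.
Proof.
apply: sum3_eq0 => x y z _ _ _; apply/eqP; rewrite eqb0 negb_and negbK.
have [//|] := boolP [&& _, _ & _]; apply: contra.
move=> /(dvdn_trans (dvdn_exp2l 2 (isT : 2 <= k.+2))).
rewrite !dvdn2 -[x]odd_double_half -[y]odd_double_half -[z]odd_double_half.
rewrite !oddD !odd_double !oddb !addbF.
by case: (odd x); case: (odd y); case: (odd z) => //= /dvdnP [t]; lia.
Qed.

(** A non-primitive solution is [p] times a triple modulo [p ^ k.+1]. Dividing by [p ^ 2] leaves the
    equation modulo [p ^ k], each of whose solutions has [p ^ 3] lifts. *)
Lemma nsol_prime_pow p k : prime p -> nsol (p ^ k.+2) = nsol_prim p k.+2 + p ^ 3 * nsol (p ^ k).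
Proof.
move=> pp; have p0 := prime_gt0 pp.
pose S q x y z : nat := q %| x ^ 2 + y ^ 2 + z ^ 2.
transitivity (nsol_prim p k.+2 +
    sum3 (p ^ k.+2) (fun x y z => [&& p %| x, p %| y & p %| z] * S (p ^ k.+2) x y z)).
  rewrite -sum3D; apply: eq_sum3 => x y z _ _ _; rewrite /S.
  by case: [&& _, _ & _] => /=; rewrite ?mul0n ?addn0 ?mul1n.
congr addn; rewrite [in sum3 _ _]expnS sum3_mul sum3_at0 // => [|u v w up vp wp]; last first.
  move=> n0; apply: sum3_eq0 => a b c _ _ _.
  rewrite !(dvdn_addl _ (dvdn_mulr _ (dvdnn p))).
  have E t : t < p -> (p %| t) = (t == 0) by move=> tp; rewrite /dvdn modn_small.
  by rewrite !E //; move: n0; rewrite !xpair_eqE -andbA; case: [&& _, _ & _].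
rewrite [in LHS](expnSr p k) sum3_mul /nsol -sum3Zl.
apply: eq_sum3 => u v w _ _ _; rewrite -sum3_const.
apply: eq_sum3 => a b c _ _ _; rewrite !add0n !dvdn_mulr // mul1n /S.
rewrite (_ : (p ^ k %| _) =
  (p ^ k %| (u + p ^ k * a) ^ 2 + (v + p ^ k * b) ^ 2 + (w + p ^ k * c) ^ 2)); last first.
  by apply: dvdn_sq3_mod; rewrite addnC mulnC modnMDl.
congr nat_of_bool; rewrite -[RHS](@dvdn_pmul2l (p ^ 2)) ?expn_gt0 ?p0 // -expnD add2n.
congr (_ %| _); [by rewrite mulnC -mulnA mulnn -expnD addn2 | ring].
Qed.

Lemma nsol_prime p : prime p -> nsol p = nsol_prim p 1 + 1.
Proof.
move=> pp; have p0 := prime_gt0 pp.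
rewrite /nsol_prim expn1.
rewrite -[X in _ + X](sum3_at0 p (fun x y z => (x, y, z) == (0, 0, 0))) //; last first.
  by move=> x y z _ _ _ /negbTE ->.
rewrite -sum3D; apply: eq_sum3 => x y z xp yp zp.
have E t : t < p -> (p %| t) = (t == 0) by move=> tp; rewrite /dvdn modn_small.
rewrite (E x xp) (E y yp) (E z zp) !xpair_eqE -andbA; case: and3P => /= [[/eqP-> /eqP-> /eqP->]|_].
  by rewrite dvdn0.
by rewrite addn0.
Qed.

(** * Three squares over a finite field of odd characteristic *)

Lemma sum_eqb1 (T : finType) (c : T) : \sum_(x : T) (x == c) = 1.
Proof. by rewrite (bigD1 c) //= eqxx big1 // => i /negbTE ->. Qed.

Section FiniteField.
Local Open Scope ring_scope.

Lemma count_sq3_field (F : finFieldType) (a b : F) : (2 : F) != 0 -> a ^+ 2 + b ^+ 2 = -1 ->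
  (\sum_(x : F) \sum_(y : F) \sum_(z : F) (x ^+ 2 + y ^+ 2 + z ^+ 2 == 0)%R = #|F| ^ 2)%N.
Proof.
move=> two_neq0 ab.
(* [h] multiplies [x^2 + y^2] by [a^2 + b^2 = -1]; after [z = u + X] the
   equation [z^2 = X^2 + Y^2] is linear in [X]. *)
pose h (t : F * F) : F * F := (a * t.1 + b * t.2, b * t.1 - a * t.2).
have hI : injective h.
  (* Applying [h] twice multiplies by [a ^ 2 + b ^ 2 = -1], so [- h] inverts [h]. *)
  apply: (can_inj (g := fun t => (- (h t).1, - (h t).2))) => -[x y].
  by congr pair; rewrite /h /= -[RHS]mul1r -[1]opprK -ab; ring.
rewrite pair_bigA (reindex_inj hI) /= -(pair_bigA _ (fun x y =>
  \sum_(z : F) ((a * x + b * y) ^+ 2 + (b * x - a * y) ^+ 2 + z ^+ 2 == 0)%R)%N) /=.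
transitivity (\sum_(X : F) \sum_(Y : F) \sum_(u : F) (u ^+ 2 + 2 * u * X == Y ^+ 2)%R)%N.
  apply: eq_bigr => X _; apply: eq_bigr => Y _.
  rewrite (reindex_inj (addIr X)) /=; apply: eq_bigr => u _; congr nat_of_bool.
  rewrite -[RHS]subr_eq0; congr (_ == _).
  transitivity ((a ^+ 2 + b ^+ 2) * (X ^+ 2 + Y ^+ 2) + (u + X) ^+ 2); first by ring.
  by rewrite ab; ring.
transitivity (\sum_(u : F) \sum_(Y : F) 1)%N; last first.
  by rewrite !sum_nat_const muln1 mulnn.
rewrite exchange_big /=; under eq_bigr => Y _ do rewrite exchange_big /=.
(* For [u = 0] the equation forces [Y = 0] and leaves [X] free; for [u != 0] each [Y] determines
   [X]. Either way there are [#|F|] pairs. *)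
rewrite exchange_big (bigD1 0) // [RHS](bigD1 0) //=; congr addn.
  transitivity (\sum_(Y : F) \sum_(X : F) (Y == 0)%R)%N.
    apply: eq_bigr => Y _; apply: eq_bigr => X _; congr nat_of_bool.
    by rewrite expr0n mulr0 mul0r addr0 eq_sym sqrf_eq0.
  by rewrite exchange_big; apply: eq_bigr => X _; rewrite sum_eqb1.
apply: eq_bigr => u u0; apply: eq_bigr => Y _.
rewrite -[RHS](sum_eqb1 _ ((Y ^+ 2 - u ^+ 2) / (2 * u))); apply: eq_bigr => X _.
have u2 : 2 * u != 0 by rewrite mulf_neq0.
congr nat_of_bool; rewrite -(inj_eq (mulfI u2) X) [in RHS]mulrCA divff // mulr1.
by rewrite addrC eq_sym -subr_eq eq_sym.
Qed.

Variable p : nat.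
Hypotheses (pp : prime p) (op : odd p).

Lemma natr_Fp_eq0 n : (n%:R == 0 :> 'F_p) = (p %| n)%N.
Proof. by rewrite -(dvdn_pcharf (pchar_Fp pp)). Qed.

(** Pigeonhole: the [(p + 1) / 2] squares and the equally many values [-1 - x], for [x] a square,
    cannot be disjoint among [p] elements. *)
Lemma sum2sq_opp1 : exists a b : 'F_p, a ^+ 2 + b ^+ 2 = -1.
Proof.
have p0 := prime_gt0 pp.
pose f (i : 'I_(p./2.+1)) : 'F_p := i%:R ^+ 2.
have fI : injective f.
  move=> i j /eqP; rewrite -subr_eq0 subr_sqr mulf_eq0 -natrD natr_Fp_eq0.
  have hi := ltn_ord i; have hj := ltn_ord j; have := odd_double_half p; rewrite op => hp.
  case/orP => [|/dvdnP [k hk]]; last first.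
    by apply: val_inj => /=; case: k hk => [|k] hk; nia.
  rewrite subr_eq0 => /eqP /(congr1 val) /=; rewrite !val_Fp_nat // !modn_small; try lia.
  exact: val_inj.
pose A := [set f i | i in [set: 'I_(p./2.+1)]]; pose B := [set -1 - x | x in A].
have cA : #|A| = p./2.+1 by rewrite card_imset // cardsT card_ord.
have cB : #|B| = p./2.+1 by rewrite -cA; apply: card_imset => x y /addrI /oppr_inj.
suff : A :&: B != finset.set0.
  case/finset.set0Pn => c; rewrite inE => /andP[/imsetP [i _ ->]] /imsetP [_ /imsetP[j _ ->]] E.
  by exists i%:R, j%:R; rewrite [X in X + _]E subrK.
rewrite -card_gt0 -(ltn_add2l #|A :|: B|) cardsUI addn0 cA cB.
apply: leq_ltn_trans (max_card _) _; rewrite card_Fp //.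
by have := odd_double_half p; rewrite op; lia.
Qed.

Lemma nsol_odd_prime : nsol p = (p ^ 2)%N.
Proof.
have [a [b ab]] := sum2sq_opp1.
have two_neq0 : (2 : 'F_p) != 0.
  by rewrite (natr_Fp_eq0 2) dvdn_prime2 //; case: eqP op => // ->.
have := count_sq3_field _ a b two_neq0 ab; rewrite card_Fp // => <-.
pose S (x y z : nat) : nat := (p %| x ^ 2 + y ^ 2 + z ^ 2)%N.
have E (F : nat -> nat) : (\sum_(x : 'F_p) F x = \sum_(x < p) F x)%N.
  by rewrite -!(big_mkord predT) Fp_cast.
transitivity (\sum_(x : 'F_p) \sum_(y : 'F_p) \sum_(z : 'F_p) S x y z)%N; last first.
  do 3![apply: eq_bigr => ? _]; congr nat_of_bool; rewrite -natr_Fp_eq0 !natrD !natrX.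
  by rewrite !natr_Zp.
rewrite [RHS](E (fun x => \sum_(y : 'F_p) \sum_(z : 'F_p) S x y z))%N; apply: eq_bigr => x _.
rewrite [RHS](E (fun y => \sum_(z : 'F_p) S x y z))%N; apply: eq_bigr => y _.
by rewrite (E (S x y)).
Qed.

End FiniteField.

Lemma nsol_prim_odd p k : prime p -> odd p -> nsol_prim p k.+1 = p ^ k.*2 * (p ^ 2).-1.
Proof.
move=> pp op; elim: k => [|k IH].
  by rewrite mul1n -(nsol_odd_prime p pp op) nsol_prime // addn1.
by rewrite nsol_prim_lift // IH mulnA -expnD doubleS !addSn.
Qed.

Lemma nsol1 : nsol 1 = 1.
Proof. by rewrite /nsol /sum3 !big_ord_recl !big_ord0. Qed.

Lemma nsol2 : nsol 2 = 4.
Proof. by rewrite /nsol /sum3 !big_ord_recl !big_ord0. Qed.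

(** The primitive count is [p ^ (k.+2).*2 - p ^ (k.+1).*2]; the subtracted term is moved to the left
    to stay in [nat]. *)
Lemma nsol_odd_prime_pow p k : prime p -> odd p ->
  nsol (p ^ k.+2) + p ^ (k.+1).*2 = p ^ (k.+2).*2 + p ^ 3 * nsol (p ^ k).
Proof.
move=> pp op; rewrite nsol_prime_pow // nsol_prim_odd // -subn1 mulnBr muln1 -expnD !doubleS addn2.
by rewrite addnAC subnK // leq_pexp2l ?prime_gt0 //; lia.
Qed.

Lemma nsol_pow2 k : nsol (2 ^ k.+2) = 8 * nsol (2 ^ k).
Proof. by rewrite nsol_prime_pow // nsol_prim2_eq0. Qed.

End Counting.

(** * The square-divisor formula *)

Section SquareDivisors.
Local Open Scope ring_scope.

(* The Dirichlet series of [wtot] is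
   (1 - 4 2^-s) / (1 - 2^-s) * zeta(s-1) / zeta(s). *)
Definition wtot (d : nat) : int := if odd d then (totient d)%:Z else - (2 * totient d)%:Z.

(** Two even arguments would break the factor [-2]; coprimality excludes them. *)
Lemma wtotM a b : coprime a b -> wtot (a * b) = wtot a * wtot b.
Proof.
move=> cab; rewrite /wtot oddM totient_coprime //.
case oa: (odd a); case ob: (odd b) => /=; try lia.
have : (2 %| gcdn a b)%N by rewrite dvdn_gcd !dvdn2 oa ob.
by rewrite (eqP cab).
Qed.

Lemma wtot1 : wtot 1 = 1.
Proof. by rewrite /wtot totient_count_coprime big_nat1. Qed.

Lemma wtot2 : wtot 2 = -2.
Proof. by rewrite /wtot totient_prime. Qed.

Lemma wtot_pow p k : prime p -> wtot (p ^ k.+2) = p%:Z * wtot (p ^ k.+1).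
Proof.
move=> pp; rewrite /wtot !oddX /= !totient_pfactor // !expnS /=.
by case: odd; rewrite !PoszM; ring.
Qed.

Lemma normr_wtot d : `|wtot d| <= 2 * d%:Z.
Proof.
have : (totient d <= d)%N.
  rewrite totient_count_coprime big_mkord -[leqRHS]muln1 -[in leqRHS](card_ord d) -sum_nat_const.
  by apply: leq_sum => i _; case: coprime.
by rewrite /wtot; case: odd; lia.
Qed.

(** The map [(d, e)] to [d * e] is inverted by [n] to [(gcdn n a, gcdn n b)]. *)
Lemma sum_divisors_coprime (V : nmodType) a b (F : nat -> V) :
    (0 < a)%N -> (0 < b)%N -> coprime a b ->
  \sum_(n <- divisors (a * b)) F n =
  \sum_(d <- divisors a) \sum_(e <- divisors b) F (d * e)%N.
Proof.
move=> a0 b0 cab; have ab0 : (0 < a * b)%N by rewrite muln_gt0 a0.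
rewrite -[RHS](big_allpairs_dep (r2 := fun _ => divisors b) (h := muln)).
apply: perm_big; apply: uniq_perm (divisors_uniq _) _ _ => [|n].
  apply: allpairs_uniq; rewrite ?divisors_uniq // => -[d e] [d' e'].
  move=> /allpairsP [[x y] /= [+ + [-> ->]]] /allpairsP [[x' y'] /= [+ + [-> ->]]].
  rewrite -!dvdn_divisors // => xa yb xa' yb' E.
  have G u v : (u %| a)%N -> (v %| b)%N -> gcdn a (u * v) = u.
    move=> ua vb; rewrite Gauss_gcdl ?(gcdn_idPr ua) //; exact: coprime_dvdr vb cab.
  have Ex : x = x' by rewrite -(G x y) // E G.
  congr pair => //; move/eqP: E; rewrite Ex eqn_pmul2l ?(dvdn_gt0 _ xa') //.
  by move/eqP.
rewrite -dvdn_divisors //; apply/idP/allpairsP => [nab|[[d e] /= []]]; last first.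
  by rewrite -!dvdn_divisors // => da eb ->; apply: dvdn_mul.
exists (gcdn n a, gcdn n b) => /=; rewrite -!dvdn_divisors // !dvdn_gcdr.
split=> //; apply/eqP; rewrite eqn_dvd; apply/andP; split.
  by rewrite muln_gcdr dvdn_gcd dvdn_mull // muln_gcdl dvdn_gcd dvdn_mulr.
rewrite Gauss_dvd ?dvdn_gcdl //; apply: coprime_dvdl (dvdn_gcdr _ _) _.
exact: coprime_dvdr (dvdn_gcdr _ _) cab.
Qed.

Lemma sum_divisors_pow (V : nmodType) p k (F : nat -> V) : prime p ->
  \sum_(n <- divisors (p ^ k)) F n = \sum_(i < k.+1) F (p ^ i)%N.
Proof.
move=> pp; rewrite -(big_mkord predT (fun i => F (p ^ i)%N)) -(big_map (expn p) predT F).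
apply: perm_big; apply: uniq_perm (divisors_uniq _) _ _ => [|n].
  by rewrite map_inj_uniq ?iota_uniq // => i j /(expnI (prime_gt1 pp)).
rewrite -dvdn_divisors ?expn_gt0 ?prime_gt0 //; apply/(dvdn_pfactor _ _ pp)/mapP.
  by move=> [m mk ->]; exists m; rewrite ?mem_index_iota.
by move=> [m + ->]; rewrite mem_index_iota => ?; exists m.
Qed.

Definition sqsum (n : nat) : int :=
  \sum_(d <- divisors n | (d ^ 2 %| n)%N) wtot d * ((n %/ d) ^ 2)%N%:Z.

(** For [d] dividing [a] and [e] dividing [b], coprimality splits the condition on [(d * e) ^ 2]
    into one for [d] and one for [e]. *)
Lemma sqsumM a b : (0 < a)%N -> (0 < b)%N -> coprime a b ->
  sqsum (a * b) = sqsum a * sqsum b.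
Proof.
move=> a0 b0 cab; rewrite /sqsum big_mkcond sum_divisors_coprime //.
rewrite [X in _ = X * _]big_mkcond [X in _ = _ * X]big_mkcond big_distrlr /=.
rewrite big_seq [RHS]big_seq; apply: eq_bigr => d; rewrite -dvdn_divisors // => da.
rewrite big_seq [RHS]big_seq; apply: eq_bigr => e; rewrite -dvdn_divisors // => eb.
have cde : coprime d e by apply: coprime_dvdl da _; apply: coprime_dvdr eb _.
rewrite expnMn Gauss_dvd ?coprimeXl ?coprimeXr // Gauss_dvdl; last first.
  by rewrite coprimeXl //; apply: coprime_dvdl da _.
rewrite Gauss_dvdr; last by rewrite coprime_sym coprimeXr //; apply: coprime_dvdr eb _.
case: ifP => [/andP[-> ->]|]; last first.
  by case: (d ^ 2 %| a)%N; case: (e ^ 2 %| b)%N => //=; rewrite ?mul0r ?mulr0.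
rewrite wtotM //; have d0 := dvdn_gt0 a0 da; have e0 := dvdn_gt0 b0 eb.
case/dvdnP: da => a' ->; case/dvdnP: eb => b' ->; rewrite mulnACA !mulnK ?muln_gt0 ?d0 //.
by rewrite expnMn PoszM; ring.
Qed.


Lemma PoszX m n : (m ^ n)%N%:Z = m%:Z ^+ n.
Proof. by rewrite -!natz natrX. Qed.

Lemma sqsum_powE p k : prime p ->
  sqsum (p ^ k) = \sum_(i < k.+1 | (i.*2 <= k)%N) wtot (p ^ i) * p%:Z ^+ (k - i).*2.
Proof.
move=> pp; rewrite /sqsum big_mkcond sum_divisors_pow // [RHS]big_mkcond; apply: eq_bigr => i _.
rewrite -expnM muln2 dvdn_Pexp2l ?prime_gt1 // -expnB ?prime_gt0 //; last by rewrite -ltnS.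
by rewrite -expnM muln2 PoszX.
Qed.

(** The index [i = 0] gives the first term. Shifting the others by one multiplies them by [p ^ 3],
    except that [wtot p] replaces [p * wtot 1]; this gives the middle term. *)
Lemma sqsum_pow p k : prime p ->
  sqsum (p ^ k.+2) =
    p%:Z ^+ (k.+2).*2 + (wtot p - p%:Z) * p%:Z ^+ (k.+1).*2 + p%:Z ^+ 3 * sqsum (p ^ k).
Proof.
move=> pp; rewrite !sqsum_powE // ![in LHS]big_mkcond big_ord_recl /= big_ord_recr /=.
rewrite [X in _ + (_ + X)]ifF; last by rewrite /bump /=; lia.
rewrite addr0 -addrA; congr (_ + _); first by rewrite mul1r.
rewrite [in RHS]big_mkcond mulr_sumr !big_ord_recl /= addrA; congr (_ + _).
  by rewrite !subSS !subn0 /= wtot1 expn1 !doubleS !exprS; ring.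
apply: eq_bigr => i _; rewrite /bump /= !add1n !doubleS !ltnS.
case: ifP => [ik|_]; last by rewrite mulr0.
rewrite wtot_pow // !subSS; have -> : (k - i = (k - i.+1).+1)%N by lia.
by rewrite !doubleS !exprS; ring.
Qed.

(** On powers of [p] both sides share two initial values and a recurrence: [wtot p - p] is [-4] for
    [p = 2], which cancels the leading power, and [-1] for odd [p]. Multiplicativity does the rest,
    splitting off the smallest prime factor. *)
Lemma nsol_sqsum n : (0 < n)%N -> (nsol n)%:Z = sqsum n.
Proof.
have PP p k : prime p -> (nsol (p ^ k))%:Z = sqsum (p ^ k).
  move=> pp; elim/ltn_ind: k => -[|[|k]] IH.
  - by rewrite sqsum_powE // expn0 nsol1 big_mkcond big_ord_recl big_ord0.
  - rewrite sqsum_powE // expn1 big_mkcond !big_ord_recl big_ord0 /= mul1r !addr0.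
    case: (even_prime pp) => [->|op]; first by rewrite nsol2.
    by rewrite nsol_odd_prime // PoszX.
  rewrite sqsum_pow // -IH //; case: (even_prime pp) => [->|op].
    by rewrite nsol_pow2 PoszM wtot2 !doubleS !exprS; ring.
  have := nsol_odd_prime_pow p k pp op => /(congr1 Posz).
  rewrite !PoszD PoszM -!PoszX => E.
  rewrite /wtot op totient_prime //.
  have -> : p.-1%:Z = p%:Z - 1 by have := prime_gt0 pp; lia.
  by rewrite addrAC -E; ring.
elim/ltn_ind: n => -[//|[|n]] IH _; first by have := PP 2%N 0 isT; rewrite expn0.
have pp := pdiv_prime (isT : (1 < n.+2)%N).
have [m cpm E] := pfactor_coprime pp (ltn0Sn n.+1).
have lg : (0 < logn (pdiv n.+2) n.+2)%N by rewrite logn_gt0 pi_pdiv.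
have m0 : (0 < m)%N by case: m E cpm => //; rewrite mul0n.
have q0 : (1 < pdiv n.+2 ^ logn (pdiv n.+2) n.+2)%N
  by rewrite -(exp1n (logn (pdiv n.+2) n.+2)) ltn_exp2r ?prime_gt1.
rewrite E nsolM ?sqsumM ?(ltnW q0) // ?coprimeXr 1?coprime_sym // PoszM PP // IH //.
by rewrite E -[ltnLHS]muln1 ltn_pmul2l.
Qed.

(** A range independent of [n] lets sums over [n] and [d] be exchanged. *)
Lemma sum_divisors_nat (V : nmodType) n N (F : nat -> V) : (0 < n <= N)%N ->
  \sum_(d <- divisors n) F d = \sum_(1 <= d < N.+1 | (d %| n)%N) F d.
Proof.
move=> /andP[n0 nN]; rewrite -[RHS]big_filter; apply: perm_big.
apply: uniq_perm (divisors_uniq _) (filter_uniq _ (iota_uniq _ _)) _ => d.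
rewrite -dvdn_divisors // mem_filter mem_index_iota; case: (boolP (d %| n)%N) => //= dn.
by rewrite (dvdn_gt0 _ dn) // ltnS (leq_trans (dvdn_leq _ dn)).
Qed.

(** Write [n = 2 ^ k * m] with [m] odd. Then [n / d] is odd only for [d = 2 ^ k * e] with [e]
    dividing [m], and the sum is [wtot (2 ^ k)] times [m], the sum of the totients of the divisors
    of [m]. *)
Lemma sum_wtot_codivisor n : (0 < n)%N ->
  \sum_(d <- divisors n | odd (n %/ d)) wtot d = if odd n then n%:Z else - n%:Z.
Proof.
move=> n0; have [m cpm E] := pfactor_coprime (isT : prime 2) n0.
move: (logn 2 n) E => k E; rewrite coprime2n in cpm.
have m0 : (0 < m)%N by case: m E cpm.
have sum_m : \sum_(e <- divisors m) wtot e = m%:Z.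
  transitivity (\sum_(e <- divisors m) totient e)%N%:Z.
    rewrite -natz natr_sum big_seq [RHS]big_seq.
    apply: eq_bigr => e; rewrite -dvdn_divisors // => em.
    by rewrite /wtot (dvdn_odd em) // natz.
  congr Posz; rewrite -[RHS]sum_totient_dvd (sum_divisors_nat _ m m) ?m0 ?leqnn //.
  by rewrite -[RHS](big_mkord (fun d => d %| m)%N totient) [RHS]big_ltn_cond //= dvd0n gtn_eqF.
have quot i e : (i <= k)%N -> (e %| m)%N -> odd (n %/ (2 ^ i * e)) = (i == k).
  move=> ik /dvdnP [m' Em]; have [m'0 e0] : (0 < m')%N /\ (0 < e)%N.
    by apply/andP; rewrite -muln_gt0 -Em.
  rewrite E Em -[in X in (X %/ _)%N](subnKC ik) expnD.
  rewrite (_ : (m' * e * (2 ^ i * 2 ^ (k - i)) = m' * 2 ^ (k - i) * (2 ^ i * e))%N); last by ring.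
  rewrite mulnK ?muln_gt0 ?expn_gt0 // oddM oddX subn_eq0.
  move: cpm; rewrite Em oddM => /andP[-> _] /=.
  by rewrite orbF eqn_leq ik.
rewrite big_mkcond {1}E mulnC sum_divisors_coprime ?expn_gt0 ?coprimeXl ?coprime2n //.
rewrite sum_divisors_pow // big_ord_recr /= big1 ?add0r => [|i _]; last first.
  rewrite big_seq big1 // => e; rewrite -dvdn_divisors // => em.
  by rewrite quot ?(ltnW (ltn_ord i)) // ltn_eqF.
transitivity (\sum_(e <- divisors m) wtot (2 ^ k) * wtot e).
  rewrite big_seq [RHS]big_seq; apply: eq_bigr => e; rewrite -dvdn_divisors // => em.
  by rewrite quot // eqxx wtotM // coprimeXl // coprime2n (dvdn_odd em).
rewrite -mulr_sumr sum_m E oddM cpm oddX orbF /wtot oddX orbF.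
case: k {E quot} => [|k]; first by rewrite -/(wtot 1) wtot1 muln1 mul1r.
by rewrite totient_pfactor //= mul1n -expnS PoszM mulNr mulrC.
Qed.

End SquareDivisors.

(** * The sum of the inverse fourth powers of odd integers *)

Section Trigonometry.
Local Open Scope classical_set_scope.
Variable R : realType.
Implicit Types x : R.

Lemma sin_lex x : 0 <= x -> sin x <= x.
Proof.
move=> x0; have D (t : R) : t \in `]0, x[%R -> is_derive t 1 (fun t => t - sin t) (1 - cos t).
  by move=> _; apply: is_deriveB.
have C : {within `[0, x], continuous (fun t : R => t - sin t)}.
  apply: continuous_subspaceT => t; apply: cvgB; [exact: cvg_id|exact: continuous_sin].
have [c] := MVT_segment x0 D C.
rewrite sin0 !subr0 => _ E; rewrite -subr_ge0 E mulr_ge0 // subr_ge0; exact: cos_le1.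
Qed.

(** This is [x <= tan x] cleared of its denominator; [sin t - t cos t] has derivative [t sin t]. *)
Lemma mulr_cos_le_sin x : 0 <= x <= pi -> x * cos x <= sin x.
Proof.
move=> /andP[x0 xpi].
have D (t : R) : t \in `]0, x[%R -> is_derive t 1 (fun t => sin t - t * cos t) (t * sin t).
  by move=> _; apply: is_derive_eq; rewrite /GRing.scale /=; ring.
have C : {within `[0, x], continuous (fun t : R => sin t - t * cos t)}.
  apply: continuous_subspaceT => t; apply: cvgB; first exact: continuous_sin.
  by apply: cvgM; [exact: cvg_id|exact: continuous_cos].
have [c] := MVT_segment x0 D C.
rewrite in_itv /= sin0 mul0r !subr0 => /andP[c0 cx] E; rewrite -subr_ge0 E.
by rewrite !mulr_ge0 // sin_ge0_pi // c0 (le_trans cx).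
Qed.

(** Square [cot^2 x <= 1 / x^2 <= 1 / sin^2 x]; with [a = 1 / sin^2 x] the left side becomes
    [(a - 1)^2 >= a^2 - 2 a]. *)
Lemma inv4_sin_bounds x : 0 < x < pi / 2 ->
  (sin x ^+ 4)^-1 - 2 * (sin x ^+ 2)^-1 <= (x ^+ 4)^-1 <= (sin x ^+ 4)^-1.
Proof.
move=> /andP[x0 x2]; have pi0 := pi_gt0 R.
have s0 : 0 < sin x by apply: sin_gt0_pihalf; rewrite x0.
have c0 : 0 < cos x by apply: cos_gt0_pihalf; lra.
have sx := sin_lex x (ltW x0).
have xc : x * cos x <= sin x by apply: mulr_cos_le_sin; lra.
apply/andP; split; last by rewrite lef_pV2 ?posrE ?exprn_gt0 // lerXn2r ?nnegrE // ltW.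
have cot2 : cos x ^+ 2 / sin x ^+ 2 <= (x ^+ 2)^-1.
  rewrite ler_pdivrMr ?exprn_gt0 // mulrC ler_pdivlMr ?exprn_gt0 // -exprMn mulrC.
  by rewrite lerXn2r ?nnegrE ?mulr_ge0 // ltW.
have cot0 : 0 <= cos x ^+ 2 / sin x ^+ 2 by rewrite divr_ge0 // sqr_ge0.
set a := (sin x ^+ 2)^-1.
have cotE : cos x ^+ 2 / sin x ^+ 2 = a - 1.
  by rewrite cos2sin2 mulrBl mul1r divff // expf_neq0 // gt_eqF.
have -> : (sin x ^+ 4)^-1 = a ^+ 2 by rewrite /a exprVn -exprM.
have -> : (x ^+ 4)^-1 = (x ^+ 2)^-1 ^+ 2 by rewrite exprVn -exprM.
by rewrite cotE in cot0 cot2; nra.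
Qed.

(** For [k < 2 ^ m] these are the odd multiples of [pi / 2 ^ m.+2] in the first quadrant. *)
Definition odd_angle m k : R := k.*2.+1%:R * pi / 2 ^+ m.+2.

Lemma odd_angle_half m k : odd_angle m k = odd_angle m.+1 k *+ 2.
Proof. by rewrite /odd_angle [2 ^+ m.+3]exprS -[RHS]mulr_natr; field; rewrite expf_neq0. Qed.

Lemma odd_angle_bounds m k : (k < 2 ^ m)%N -> 0 < odd_angle m k < pi / 2.
Proof.
move=> km; have pi0 := pi_gt0 R.
have p0 : 0 < 2 ^+ m.+2 :> R by rewrite exprn_gt0.
rewrite /odd_angle; apply/andP; split; first by rewrite divr_gt0 // mulr_gt0 // ltr0n.
rewrite ltr_pdivrMr //.
rewrite mulrC -mulrA ltr_pM2l // exprS mulrA mulVf // mul1r -natrX ltr_nat expnS; lia.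
Qed.

(** Symmetry about [pi / 4] pairs the upper half of the indices with the lower half. *)
Lemma odd_angle_reflect m k : (k < 2 ^ m)%N ->
  odd_angle m.+1 (2 ^ m.+1 - k.+1) = pi / 2 - odd_angle m.+1 k.
Proof.
move=> km; rewrite /odd_angle.
have -> : (2 ^ m.+1 - k.+1).*2.+1%:R = 2 ^+ m.+2 - k.*2.+1%:R :> R.
  by rewrite -natrX -natrB; [congr _%:R|]; rewrite ?expnS; lia.
by rewrite [2 ^+ m.+3]exprS; field; rewrite expf_neq0.
Qed.

(* Since [1 / sin^2 t + 1 / cos^2 t = 4 / sin^2 (2 t)], with a similar identity for
   fourth powers, this yields recurrences in [m] for the sums of [1 / sin^2] and
   [1 / sin^4]. *)
Lemma sum_odd_angleS m (F : R -> R) :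
  \sum_(k < 2 ^ m.+1) F (odd_angle m.+1 k) =
  \sum_(k < 2 ^ m) (F (odd_angle m.+1 k) + F (pi / 2 - odd_angle m.+1 k)).
Proof.
rewrite big_split -!(big_mkord predT (fun k => F (_ k))).
rewrite (@big_cat_nat _ _ _ (2 ^ m)%N) //=; last by rewrite leq_exp2l.
congr (_ + _).
rewrite -{1}[(2 ^ m)%N]add0n expnS mul2n -addnn big_addn addnK big_nat_rev /= add0n.
rewrite !big_mkord; apply: eq_bigr => k _; rewrite -odd_angle_reflect //; congr (F (odd_angle _ _)).
by have := ltn_ord k; rewrite expnS; lia.
Qed.

Definition sum_inv_sin n m : R := \sum_(k < 2 ^ m) (sin (odd_angle m k) ^+ n)^-1.

Lemma sin_pi4 : sin (pi / 4 : R) ^+ 2 = 2^-1.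
Proof.
have := cos2Dsin2 (pi / 4 : R); have := cosBpihalf (pi / 4 : R).
rewrite (_ : pi / 4 - pi / 2 = - (pi / 4)) ?cosN; last by field.
by move=> ->; lra.
Qed.

Lemma sum_inv_sin2 m : sum_inv_sin 2 m = 2 * 4 ^+ m.
Proof.
rewrite /sum_inv_sin; elim: m => [|m IH].
  by rewrite big_ord_recl big_ord0 /odd_angle /= mul1r -natrX sin_pi4 invrK addr0 mulr1.
rewrite (sum_odd_angleS m (fun t => (sin t ^+ 2)^-1)) exprS mulrCA -IH mulr_sumr.
apply: eq_bigr => k _; have := odd_angle_bounds m k (ltn_ord k).
rewrite odd_angle_half sin_mulr2n; set t := odd_angle _ _ => tb; have pi0 := pi_gt0 R.
have -> : sin (pi / 2 - t) = cos t by rewrite -cosBpihalf -cosN; congr cos; ring.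
have s0 : sin t != 0 by rewrite gt_eqF // sin_gt0_pihalf; lra.
have c0 : cos t != 0 by rewrite gt_eqF // cos_gt0_pihalf; lra.
transitivity ((cos t ^+ 2 + sin t ^+ 2) / (cos t ^+ 2 * sin t ^+ 2)); first by field; apply/andP.
by rewrite cos2Dsin2 -[cos t * sin t *+ 2]mulr_natr; field; apply/andP.
Qed.

(** From [1 / sin^4 t + 1 / cos^4 t = 16 / sin^4 (2 t) - 8 / sin^2 (2 t)], a recurrence starting at
    [1 / sin^4 (pi / 4) = 4]. *)
Lemma sum_inv_sin4 m : sum_inv_sin 4 m = (8 * 16 ^+ m + 4 * 4 ^+ m) / 3.
Proof.
elim: m => [|m IH].
  rewrite /sum_inv_sin big_ord_recl big_ord0 /odd_angle /= mul1r -natrX addr0.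
  by rewrite -[4%N]/(2 * 2)%N exprM sin_pi4; field.
transitivity (16 * sum_inv_sin 4 m - 8 * sum_inv_sin 2 m); last first.
  by rewrite IH sum_inv_sin2 !exprS; field.
rewrite /sum_inv_sin (sum_odd_angleS m (fun t => (sin t ^+ 4)^-1)) !mulr_sumr -sumrB.
apply: eq_bigr => k _; have := odd_angle_bounds m k (ltn_ord k).
rewrite odd_angle_half sin_mulr2n; set t := odd_angle _ _ => tb; have pi0 := pi_gt0 R.
have -> : sin (pi / 2 - t) = cos t by rewrite -cosBpihalf -cosN; congr cos; ring.
have s0 : sin t != 0 by rewrite gt_eqF // sin_gt0_pihalf; lra.
have c0 : cos t != 0 by rewrite gt_eqF // cos_gt0_pihalf; lra.
transitivity (((cos t ^+ 2 + sin t ^+ 2) ^+ 2 - 2 * (cos t ^+ 2 * sin t ^+ 2)) /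
  (cos t ^+ 2 * sin t ^+ 2) ^+ 2); first by field; apply/andP.
by rewrite cos2Dsin2 -[cos t * sin t *+ 2]mulr_natr; field; apply/andP.
Qed.

(** The scaled sum lies between [sum_inv_sin 4 m - 2 * sum_inv_sin 2 m] and [sum_inv_sin 4 m], both
    [8/3 * 16 ^ m] up to a multiple of [4 ^ m]. *)
Lemma sum_odd_inv4 m :
  `|\sum_(k < 2 ^ m) (k.*2.+1%:R ^+ 4)^-1 - pi ^+ 4 / 96| <= pi ^+ 4 / 4 ^+ m :> R.
Proof.
have pi0 := pi_gt0 R; have p0 : 0 < 4 ^+ m :> R by rewrite exprn_gt0.
(* The fourth power of [2 ^ m.+2 / pi], which turns [1 / (2k+1)^4] into the inverse fourth power of
   the angle. *)
pose c : R := 256 * 16 ^+ m / pi ^+ 4.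
have pE : 16 ^+ m = 4 ^+ m ^+ 2 :> R by rewrite -exprM mulnC exprM; congr (_ ^+ _); ring.
have c0 : 0 < c.
  apply: divr_gt0; last exact: exprn_gt0.
  by apply: mulr_gt0; [rewrite ltr0n|rewrite exprn_gt0 // ltr0n].
have E : c * \sum_(k < 2 ^ m) (k.*2.+1%:R ^+ 4)^-1 = \sum_(k < 2 ^ m) (odd_angle m k ^+ 4)^-1.
  rewrite mulr_sumr; apply: eq_bigr => k _; rewrite /odd_angle /c pE.
  have -> : 2 ^+ m.+2 = 4 * 2 ^+ m :> R by rewrite !exprS; ring.
  have -> : 4 ^+ m = (2 ^+ m) ^+ 2 :> R by rewrite -exprM mulnC exprM; congr (_ ^+ _); ring.
  move: (pi : R) (pi_gt0 R) => w w0; field.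
  by rewrite expf_neq0 ?pnatr_eq0 // !gt_eqF // -natrS ltr0n.
have up : c * \sum_(k < 2 ^ m) (k.*2.+1%:R ^+ 4)^-1 <= sum_inv_sin 4 m.
  rewrite E; apply: ler_sum => k _.
  by have /andP[] := inv4_sin_bounds _ (odd_angle_bounds m k (ltn_ord k)).
have lo : sum_inv_sin 4 m - 2 * sum_inv_sin 2 m <= c * \sum_(k < 2 ^ m) (k.*2.+1%:R ^+ 4)^-1.
  rewrite E mulr_sumr -sumrB; apply: ler_sum => k _.
  by have /andP[] := inv4_sin_bounds _ (odd_angle_bounds m k (ltn_ord k)).
rewrite sum_inv_sin4 sum_inv_sin2 in up lo.
rewrite -(ler_pM2l c0) -{1}(gtr0_norm c0) -normrM mulrBr.
have -> : c * (pi ^+ 4 / 96) = 8 / 3 * 16 ^+ m.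
  by rewrite /c; move: (pi : R) (pi_gt0 R) => w w0; field; rewrite gt_eqF.
have -> : c * (pi ^+ 4 / 4 ^+ m) = 256 * 4 ^+ m
  by rewrite /c pE; move: (pi : R) (pi_gt0 R) => w w0; field; rewrite !gt_eqF.
by rewrite ler_norml; lra.
Qed.

End Trigonometry.

(** * Partial sums *)

(** The bound [N %/ q] grows exactly when [q] divides the new index [N.+1]. *)
Lemma sum_multiples (V : nmodType) q N (F : nat -> V) : (0 < q)%N ->
  \sum_(1 <= r < N.+1 | (q %| r)%N) F (r %/ q)%N = \sum_(1 <= m < (N %/ q).+1) F m.
Proof.
move=> q0; elim: N => [|N IH]; first by rewrite div0n !big_geq.
rewrite big_mkcond big_nat_recr //= -big_mkcond IH divnS //.
case: ifP => qN; last by rewrite addr0.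
by rewrite qN [RHS]big_nat_recr.
Qed.

(** Used with [q d = d ^ 2] for square divisors and with [q d = d] for the convolution. *)
Lemma sum_divisor_exchange (V : nmodType) N (q : nat -> nat) (G : nat -> nat -> V) :
    (forall d, (0 < d)%N -> (0 < q d)%N) ->
  \sum_(1 <= r < N.+1) \sum_(1 <= d < N.+1 | (q d %| r)%N) G d (r %/ q d)%N =
  \sum_(1 <= d < N.+1) \sum_(1 <= m < (N %/ q d).+1) G d m.
Proof.
move=> q0; under eq_bigr => r _ do rewrite big_mkcond.
rewrite exchange_big /= big_nat [RHS]big_nat; apply: eq_bigr => d /andP[d0 _].
by rewrite -big_mkcond sum_multiples ?q0.
Qed.

Section Analysis.
Variable R : realType.

(** The right side is [2 / ((n+1)(n+2))], and [n + 2 <= 2 (n + 1)]. *)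
Lemma inv_sq_le_telescope n : (n.+1%:R ^+ 2)^-1 <= 2 / n.+1%:R - 2 / n.+2%:R :> R.
Proof.
have n0 : 0 <= n%:R :> R by [].
rewrite -[n.+2]addn2 -[n.+1]addn1 !natrD; move: (n%:R : R) n0 => x x0.
have -> : 2 / (x + 1) - 2 / (x + 2) = 2 / ((x + 1) * (x + 2)) :> R.
  by field; rewrite !gt_eqF //; lra.
rewrite -[leLHS]mul1r ler_pdivlMr ?mulr_gt0; try lra.
rewrite mulrAC ler_pdivrMr ?exprn_gt0; try lra.
nra.
Qed.

Lemma sum_inv_sq_le N : \sum_(1 <= d < N.+1) (d%:R ^+ 2)^-1 <= 2 :> R.
Proof.
suff : \sum_(1 <= d < N.+1) (d%:R ^+ 2)^-1 <= 2 - 2 / N.+1%:R :> R.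
  by move=> /le_trans; apply; rewrite gerBl divr_ge0.
elim: N => [|N IH]; first by rewrite big_geq // divr1 subrr.
by rewrite big_nat_recr //= (le_trans (lerD IH (inv_sq_le_telescope N))) // addrA subrK.
Qed.

(** Each new term satisfies [1/k <= - ln (1 - 1/k) = ln k - ln (k - 1)]. *)
Lemma harmonic_le_ln n : (0 < n)%N -> \sum_(1 <= d < n.+1) (d%:R)^-1 <= 1 + ln n%:R :> R.
Proof.
case: n => // n _; elim: n => [|n IH]; first by rewrite big_nat1 ln1 invr1 addr0.
rewrite big_nat_recr //=; apply: le_trans (lerD IH (lexx _)) _.
rewrite -addrA lerD2l.
have n1 : 0 < n.+1%:R :> R by rewrite ltr0n.
have n2 : 0 < n.+2%:R :> R by rewrite ltr0n.
have : ln (1 + (- (n.+2%:R)^-1)) <= - (n.+2%:R)^-1 :> R.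
  by apply: le_ln1Dx; rewrite ltrN2 invf_lt1 // ltr1n.
have -> : 1 - (n.+2%:R)^-1 = n.+1%:R / n.+2%:R :> R.
  by rewrite -[n.+1%:R](addrK 1) natr1 mulrBl divff ?gt_eqF // mul1r.
rewrite ln_div ?posrE //.
by move: (ln n.+1%:R) (ln n.+2%:R) (n.+2%:R^-1) => u v w; lra.
Qed.

Lemma sum_sqE M : \sum_(1 <= m < M.+1) m%:R ^+ 2 = M%:R * (M%:R + 1) * (2 * M%:R + 1) / 6 :> R.
Proof.
elim: M => [|M IH]; first by rewrite big_geq // !mul0r.
by rewrite big_nat_recr //= IH -natr1; field.
Qed.

(* For [y < 1] the sum is empty and [y^3 <= y^2]: no cutoff [d^2 <= x] is needed
   when this is summed over [y = x / d^2]. *)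
Lemma sum_sq_approx M (y : R) : M%:R <= y < M.+1%:R ->
  `|\sum_(1 <= m < M.+1) m%:R ^+ 2 - y ^+ 3 / 3| <= 3 * y ^+ 2.
Proof.
rewrite sum_sqE; case: M => [|M] /andP[].
  move=> y0 y1; rewrite !mul0r sub0r normrN ger0_norm ?divr_ge0 ?exprn_ge0 //.
  by rewrite exprS; nra.
have : 1 <= M.+1%:R :> R by rewrite ler1n.
rewrite -[M.+2%:R]natr1; move: (M.+1%:R : R) => u u1 uy yu.
have y3l : u ^+ 3 <= y ^+ 3 by rewrite lerXn2r ?nnegrE; lra.
have y3u : y ^+ 3 <= (u + 1) ^+ 3 by rewrite lerXn2r ?nnegrE; lra.
have y2 : u ^+ 2 <= y ^+ 2 by rewrite lerXn2r ?nnegrE; lra.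
have uu : u <= u ^+ 2 by rewrite expr2; nra.
by rewrite ler_norml; apply/andP; split; lra.
Qed.

(** Supplies the hypothesis of [sum_sq_approx] for [M = n %/ q] and [y = x / q]. *)
Lemma divn_floor n q (x : R) : (0 < q)%N -> n%:R <= x < n.+1%:R ->
  (n %/ q)%:R <= x / q%:R < (n %/ q).+1%:R.
Proof.
move=> q0 /andP[nx xn]; have q0' : 0 < q%:R :> R by rewrite ltr0n.
rewrite ler_pdivlMr // ltr_pdivrMr // -!natrM; apply/andP; split.
  by apply: le_trans nx; rewrite ler_nat leq_divM.
by apply: lt_le_trans xn _; rewrite ler_nat ltn_ceil.
Qed.

Definition wtotR d : R := (wtot d)%:~R.

Lemma normr_wtotR d : `|wtotR d| <= 2 * d%:R.
Proof.
by rewrite /wtotR -intr_norm; have := normr_wtot d; rewrite -(ler_int R) intrM.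
Qed.

Definition wtot_sum4 N : R := \sum_(1 <= d < N.+1) wtotR d / d%:R ^+ 4.

(** Writing [(r / d)^2 = d^2 (r / d^2)^2] makes each term a function of [d] and [r %/ d ^ 2], as the
    exchange of sums requires. *)
Lemma nsolE r N : (0 < r <= N)%N ->
  (nsol r)%:R = \sum_(1 <= d < N.+1 | (d ^ 2 %| r)%N)
    wtotR d * d%:R ^+ 2 * (r %/ d ^ 2)%:R ^+ 2 :> R.
Proof.
move=> rN; have /andP[r0 _] := rN.
rewrite -[LHS]/((nsol r)%:Z%:~R) nsol_sqsum // /sqsum big_mkcond (sum_divisors_nat _ r N) //.
rewrite raddf_sum /= big_mkcond [RHS]big_mkcond; apply: eq_bigr => d _.
have [dr|ndr] := boolP (d ^ 2 %| r)%N; last by case: ifP => //.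
rewrite (dvdn_trans _ dr) ?dvdn_exp // intrM /wtotR -mulrA; congr (_ * _).
rewrite -exprMn -natrM -natrX; congr (_ %:R); congr (_ ^ _)%N.
have /dvdnP[t Et] := dr; have d0 : (0 < d)%N.
  by rewrite lt0n; apply: contraTneq dr => ->; rewrite exp0n // dvd0n -lt0n.
by rewrite Et mulnK ?expn_gt0 ?d0 // -mulnn mulnA mulnK // mulnC.
Qed.

(** For each [d], [sum_sq_approx] at [y = x / d^2] and [|wtotR d| <= 2 d] give an error of at most
    [2 d * d^2 * 3 y^2 = 6 x^2 / d]. *)
Lemma sum_nsol_approx n (x : R) : n%:R <= x < n.+1%:R ->
  `|\sum_(1 <= r < n.+1) (nsol r)%:R - x ^+ 3 / 3 * wtot_sum4 n| <=
  6 * x ^+ 2 * \sum_(1 <= d < n.+1) (d%:R)^-1.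
Proof.
move=> nx.
have -> : \sum_(1 <= r < n.+1) (nsol r)%:R =
    \sum_(1 <= d < n.+1) \sum_(1 <= m < (n %/ d ^ 2).+1) wtotR d * d%:R ^+ 2 * m%:R ^+ 2 :> R.
  rewrite -(sum_divisor_exchange _ _ (fun d => d ^ 2)%N (fun d m => wtotR d * d%:R ^+ 2 * m%:R ^+ 2)).
    rewrite big_nat [RHS]big_nat; apply: eq_bigr => r /andP[r0 rn]; rewrite (nsolE r n) //.
    by rewrite r0.
  by move=> d d0; rewrite expn_gt0 d0.
rewrite /wtot_sum4 !mulr_sumr -sumrB; apply: le_trans (ler_norm_sum _ _ _) _.
rewrite big_nat [leRHS]big_nat; apply: ler_sum => d /andP[d0 _].
have dR : 0 < d%:R :> R by rewrite ltr0n.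
have dq : (0 < d ^ 2)%N by rewrite expn_gt0 d0.
rewrite -mulr_sumr.
have -> : x ^+ 3 / 3 * (wtotR d / d%:R ^+ 4) = wtotR d * d%:R ^+ 2 * ((x / (d ^ 2)%:R) ^+ 3 / 3).
  by rewrite natrX; field; rewrite gt_eqF.
rewrite -mulrBr 2!normrM; have := sum_sq_approx _ _ (divn_floor _ _ _ dq nx).
set E := `|_ - _| => hE; rewrite (ger0_norm (sqr_ge0 _)).
apply: le_trans (_ : 2 * d%:R * d%:R ^+ 2 * (3 * (x / (d ^ 2)%:R) ^+ 2) <= _).
  by rewrite ler_pM ?mulr_ge0 ?sqr_ge0 ?normr_ge0 // ler_pM2r ?exprn_gt0 ?normr_wtotR.
by rewrite le_eqVlt; apply/orP; left; apply/eqP; rewrite natrX; field; rewrite gt_eqF.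
Qed.

End Analysis.

(** * Rates of convergence *)

Section Rates.
Variable R : realType.

Lemma dist_small_eq (a b c : R) : (forall n, `|a - b| <= c / n.+1%:R) -> a = b.
Proof.
move=> h; apply/eqP; rewrite -subr_eq0 -normr_le0 leNgt; apply/negP => ab0.
have c0 : 0 <= c by have := h 0%N; rewrite divr1; apply: le_trans.
have := h (Num.truncn (c / `|a - b|)); rewrite leNgt => /negP; apply.
rewrite ltr_pdivrMr ?ltr0n // mulrC -ltr_pdivrMr //.
by have /andP[] := truncn_itv (divr_ge0 c0 (ltW ab0)).
Qed.

(** While [u n] is nondecreasing, [u n + 2 / n.+1] is nonincreasing, so the limit lies between
    them. *)
Lemma telescope_rate (u : nat -> R) :
    (forall n, 0 <= u n.+1 - u n <= 2 / n.+1%:R - 2 / n.+2%:R) ->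
  cvgn u /\ forall n, `|u n - limn u| <= 2 / n.+1%:R.
Proof.
move=> h; have nd : nondecreasing_seq u.
  by apply/nondecreasing_seqP => n; have /andP[] := h n; rewrite subr_ge0.
have ub n m : (n <= m)%N -> u m <= u n + 2 / n.+1%:R.
  move=> nm; suff : u m + 2 / m.+1%:R <= u n + 2 / n.+1%:R.
    by apply: le_trans; rewrite lerDl divr_ge0.
  elim: m nm => [|m IH]; first by rewrite leqn0 => /eqP ->.
  rewrite leq_eqVlt => /orP[/eqP -> //|]; rewrite ltnS => /IH; apply: le_trans.
  have /andP[_] := h m.
  by move: (u m.+1) (u m) (2 / m.+1%:R : R) (2 / m.+2%:R : R) => a b c e; lra.
have cu : cvgn u.
  apply: nondecreasing_is_cvgn => //; exists (u 0%N + 2 / 1) => _ [m _ <-].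
  exact: ub.
split=> // n; rewrite distrC ger0_norm ?subr_ge0; last exact: nondecreasing_cvgn_le.
rewrite lerBlDl; apply: limr_le => //.
by near=> m; apply: ub; near: m; exists n.
Unshelve. all: by end_near. Qed.

Definition zeta3_sum n : R := \sum_(1 <= k < n.+1) (k%:R ^+ 3)^-1.

Lemma inv_expr_le m k : (2 <= m)%N -> (0 < k)%N -> (k%:R ^+ m)^-1 <= (k%:R ^+ 2)^-1 :> R.
Proof.
move=> m2 k0; rewrite lef_pV2 ?posrE ?exprn_gt0 ?ltr0n //.
by apply: ler_weXn2l; rewrite ?ler1n.
Qed.

Lemma zeta3_sum_rate n : `|zeta3_sum n - zeta (3 : R)| <= 2 / n.+1%:R.
Proof.
have -> : zeta (3 : R) = limn zeta3_sum.
  rewrite /zeta; congr (limn _); apply/funext => N; rewrite /series /= /zeta3_sum big_add1 /=.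
  by apply: eq_bigr => k _; rewrite powRN powR_mulrn.
apply: (telescope_rate zeta3_sum _).2 => {}n; rewrite /zeta3_sum big_nat_recr //= addrAC subrr add0r.
rewrite invr_ge0 exprn_ge0 //=; apply: le_trans (inv_sq_le_telescope R n).
exact: inv_expr_le.
Qed.

Definition odd_sum4 n : R := \sum_(1 <= e < n.+1 | odd e) (e%:R ^+ 4)^-1.

Lemma odd_sum4S n : odd_sum4 n.+1 = odd_sum4 n + (if odd n.+1 then (n.+1%:R ^+ 4)^-1 else 0).
Proof. by rewrite /odd_sum4 big_mkcond [in RHS]big_mkcond [LHS]big_nat_recr. Qed.

Lemma odd_sum4_double K : odd_sum4 K.*2 = \sum_(k < K) (k.*2.+1%:R ^+ 4)^-1.
Proof.
elim: K => [|K IH]; first by rewrite /odd_sum4 big_geq // big_ord0.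
by rewrite doubleS !odd_sum4S IH /= odd_double /= addr0 big_ord_recr.
Qed.

(** Telescoping gives the rate; the limit is identified along [n = 2 * 2 ^ m], where [sum_odd_inv4]
    applies. *)
Lemma odd_sum4_rate n : `|odd_sum4 n - pi ^+ 4 / 96| <= 2 / n.+1%:R.
Proof.
have h k : 0 <= odd_sum4 k.+1 - odd_sum4 k <= 2 / k.+1%:R - 2 / k.+2%:R.
  rewrite odd_sum4S addrAC subrr add0r.
  have p : 0 <= (k.+1%:R ^+ 4)^-1 :> R by rewrite invr_ge0 exprn_ge0.
  have q : (k.+1%:R ^+ 4)^-1 <= 2 / k.+1%:R - 2 / k.+2%:R :> R.
    by apply: le_trans (inv_sq_le_telescope R k); apply: inv_expr_le.
  by case: ifP => _; rewrite ?p ?q // lexx (le_trans p).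
have [_ rate] := telescope_rate _ h.
suff <- : limn odd_sum4 = pi ^+ 4 / 96 by [].
apply: (dist_small_eq _ _ (2 + pi ^+ 4)) => m.
have := sum_odd_inv4 R m; rewrite -odd_sum4_double => h1.
have := rate (2 ^ m).*2; rewrite distrC => h2.
rewrite -(subrK (odd_sum4 (2 ^ m).*2) (limn odd_sum4)) -addrA; apply: le_trans (ler_normD _ _) _.
have mm : (m < 2 ^ m)%N by apply: ltn_expl.
rewrite mulrDl; apply: lerD.
  apply: le_trans h2 _; rewrite ler_pM2l // lef_pV2 ?posrE ?ltr0n // ler_nat; lia.
apply: le_trans h1 _; rewrite ler_wpM2l ?exprn_ge0 ?pi_ge0 // lef_pV2 ?posrE ?ltr0n ?exprn_gt0 //.
rewrite -natrX ler_nat -[4%N]/(2 ^ 2)%N -expnM; apply: leq_trans mm _.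
by rewrite leq_exp2l; lia.
Qed.

Definition alt_sum3 n : R := \sum_(1 <= k < n.+1) (if odd k then 1 else -1) / k%:R ^+ 3.

(** Flipping the sign at [k = 2 t] subtracts [2 / (2 t)^3 = 1 / (4 t^3)]. *)
Lemma alt_sum3E n : alt_sum3 n = zeta3_sum n - zeta3_sum n./2 / 4.
Proof.
have E : \sum_(1 <= k < n.+1 | (2 %| k)%N) ((k %/ 2)%:R ^+ 3)^-1 = zeta3_sum n./2.
  by rewrite (sum_multiples R 2 n (fun k => (k%:R ^+ 3)^-1)) // divn2.
rewrite -E /alt_sum3 /zeta3_sum mulr_suml [in X in _ = _ - X]big_mkcond -sumrB
  big_nat [RHS]big_nat; apply: eq_bigr => k /andP[k0 _].
rewrite dvdn2; case: (boolP (odd k)) => [_|] /=; first by rewrite mul1r subr0.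
rewrite -dvdn2 => /dvdnP[t Et]; rewrite Et mulnK //.
have t0 : t%:R != 0 :> R by rewrite pnatr_eq0; move: k0; rewrite Et; case: t {Et}.
by rewrite natrM; field.
Qed.

Lemma alt_sum3_rate n : `|alt_sum3 n - 3 / 4 * zeta (3 : R)| <= 3 / n.+1%:R.
Proof.
have h1 := zeta3_sum_rate n; have := zeta3_sum_rate n./2; rewrite alt_sum3E.
(* A quarter of this bound, added to [2 / n.+1], gives the constant 3. *)
have : 2 / n./2.+1%:R <= 4 / n.+1%:R :> R.
  rewrite ler_pdivrMr ?ltr0n // mulrAC ler_pdivlMr ?ltr0n // -!natrM ler_nat; lia.
move: (n.+1%:R^-1 : R) (2 / n./2.+1%:R : R) (zeta3_sum n) (zeta3_sum _) (zeta _) h1 => i j z z' y.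
by rewrite !ler_norml => /andP[? ?] ? /andP[? ?]; apply/andP; split; lra.
Qed.

(** Grouping the pairs by [n = d * e], [sum_wtot_codivisor] divided by [n^4] gives the term
    [+-1 / n^3]. *)
Lemma alt_sum3_convolution N :
  alt_sum3 N = \sum_(1 <= d < N.+1) \sum_(1 <= e < N.+1 | odd e && (d * e <= N)%N)
     wtotR R d / d%:R ^+ 4 * (e%:R ^+ 4)^-1.
Proof.
transitivity (\sum_(1 <= d < N.+1) \sum_(1 <= e < (N %/ d).+1)
    if odd e then wtotR R d / d%:R ^+ 4 * (e%:R ^+ 4)^-1 else 0); last first.
  rewrite big_nat [RHS]big_nat; apply: eq_bigr => d /andP[d0 _].
  rewrite (big_nat_widen _ _ N.+1) ?ltnS ?leq_div //.
  rewrite big_mkcond [RHS]big_mkcond; apply: eq_bigr => e _.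
  by rewrite ltnS leq_divRL // mulnC; case: (odd e); case: (d * e <= N)%N.
have /= <- := sum_divisor_exchange _ N id (fun d e =>
  if odd e then wtotR R d / d%:R ^+ 4 * (e%:R ^+ 4)^-1 else 0) (fun d (d0 : (0 < d)%N) => d0).
rewrite /alt_sum3 [LHS]big_nat [RHS]big_nat; apply: eq_bigr => n /andP[n0 nN].
have nR : n%:R != 0 :> R by rewrite pnatr_eq0 -lt0n.
transitivity (\sum_(1 <= d < N.+1 | (d %| n)%N) (if odd (n %/ d) then wtotR R d else 0) / n%:R ^+ 4).
  rewrite -mulr_suml -(sum_divisors_nat _ n N (fun d => if odd (n %/ d) then wtotR R d else 0)) ?n0 //.
  rewrite -big_mkcond -raddf_sum sum_wtot_codivisor //.
  by case: odd; rewrite ?rmorphN /=; field.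
apply: eq_bigr => d dn; case: ifP => _; last by rewrite mul0r.
have /dvdnP[t Et] := dn.
have [t0 d0] : (0 < t)%N /\ (0 < d)%N by apply/andP; rewrite -muln_gt0 -Et.
by rewrite Et mulnK // natrM; field; rewrite !pnatr_eq0 -!lt0n t0.
Qed.

(* Only pairs with [d * e >= N + 1] contribute to the difference, so a factor
   [1 / (d e)] can be traded for [1 / (N + 1)]. *)
Lemma wtot_sum4_odd_sum4 N : `|wtot_sum4 R N * odd_sum4 N - alt_sum3 N| <= 8 / N.+1%:R.
Proof.
have -> : wtot_sum4 R N * odd_sum4 N - alt_sum3 N =
    \sum_(1 <= d < N.+1) \sum_(1 <= e < N.+1 | odd e && (N < d * e)%N)
      wtotR R d / d%:R ^+ 4 * (e%:R ^+ 4)^-1.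
  rewrite alt_sum3_convolution mulr_suml -sumrB; apply: eq_bigr => d _.
  rewrite mulr_sumr (bigID (fun e => d * e <= N)%N) /= addrAC subrr add0r.
  by apply: eq_bigl => e; rewrite ltnNge.
have S0 k : 0 <= \sum_(1 <= d < k) (d%:R ^+ 2)^-1 :> R.
  by apply: sumr_ge0 => d _; rewrite invr_ge0 sqr_ge0.
apply: le_trans (ler_norm_sum _ _ _) _.
apply: le_trans (_ : \sum_(1 <= d < N.+1) \sum_(1 <= e < N.+1)
    2 / N.+1%:R * (d%:R ^+ 2)^-1 * (e%:R ^+ 2)^-1 <= _); last first.
  under eq_bigr => d _ do rewrite -mulr_sumr.
  rewrite -mulr_suml -mulr_sumr -mulrA.
  have -> : 8 / N.+1%:R = 2 / N.+1%:R * (2 * 2) :> R by ring.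
  by rewrite ler_wpM2l ?divr_ge0 // ler_pM // sum_inv_sq_le.
rewrite big_nat [leRHS]big_nat; apply: ler_sum => d /andP[d0 _].
apply: le_trans (ler_norm_sum _ _ _) _.
rewrite big_mkcond big_nat [leRHS]big_nat; apply: ler_sum => e /andP[e0 _].
have dR : 1 <= d%:R :> R by rewrite ler1n.
have eR : 1 <= e%:R :> R by rewrite ler1n.
case: ifP => [/andP[_ Nde]|_]; last first.
  by rewrite !mulr_ge0 ?invr_ge0 ?sqr_ge0.
have NR : N.+1%:R <= d%:R * e%:R :> R by rewrite -natrM ler_nat.
have N0 : 0 < N.+1%:R :> R by rewrite ltr0n.
have d0R : 0 < d%:R :> R by rewrite ltr0n.
have e0R : 0 < e%:R :> R by rewrite ltr0n.
rewrite !normrM !normfV !normrX !(ger0_norm (ler0n _ _)).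
apply: le_trans (_ : 2 * d%:R / d%:R ^+ 4 / e%:R ^+ 4 <= _).
  by rewrite !ler_wpM2r ?invr_ge0 ?exprn_ge0 ?normr_wtotR.
(* Besides the inverse squares there remains [1 / (d e) * 1 / e], where [1 / (d e) <= 1 / N.+1] and
   [1 / e <= 1]. *)
have -> : 2 * d%:R / d%:R ^+ 4 / e%:R ^+ 4 =
   2 * (d%:R ^+ 2)^-1 * (e%:R ^+ 2)^-1 * ((d%:R * e%:R) ^-1 * e%:R^-1) :> R.
  by field; rewrite !gt_eqF.
have -> : 2 / N.+1%:R / d%:R ^+ 2 / e%:R ^+ 2 =
   2 * (d%:R ^+ 2)^-1 * (e%:R ^+ 2)^-1 * (N.+1%:R)^-1 :> R by ring.
apply: ler_wpM2l; first by rewrite !mulr_ge0 ?invr_ge0 ?sqr_ge0.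
rewrite -[leRHS]mulr1; apply: ler_pM; rewrite ?invr_ge0 ?mulr_ge0 ?ler0n //.
  by rewrite lef_pV2 ?posrE ?mulr_gt0.
by rewrite invf_le1.
Qed.

Lemma normr_wtot_sum4 N : `|wtot_sum4 R N| <= 4.
Proof.
apply: le_trans (ler_norm_sum _ _ _) _.
apply: le_trans (_ : \sum_(1 <= d < N.+1) 2 * (d%:R ^+ 2)^-1 <= _); last first.
  by rewrite -mulr_sumr; have := sum_inv_sq_le R N; lra.
rewrite big_nat [leRHS]big_nat; apply: ler_sum => d /andP[d0 _].
have d0R : 0 < d%:R :> R by rewrite ltr0n.
rewrite normrM normfV normrX (ger0_norm (ler0n _ _)) ler_pdivrMr ?exprn_gt0 //.
apply: le_trans (normr_wtotR R d) _.
have -> : 2 * d%:R ^- 2 * d%:R ^+ 4 = 2 * d%:R * d%:R :> R by field; rewrite gt_eqF.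
by rewrite ler_peMr ?mulr_ge0 // ler1n.
Qed.

(** Multiplying by [pi^4 / 96] compares with the limit [3/4 zeta(3)], so [72 = 96 * 3/4]. The three
    errors have constants [4 * 2], [8] and [3], and [1824 = 96 * 19]. *)
Lemma wtot_sum4_rate N :
  `|wtot_sum4 R N - 72 * zeta (3 : R) / pi ^+ 4| <= 1824 / pi ^+ 4 / N.+1%:R.
Proof.
have w0 : 0 < pi ^+ 4 / 96 :> R by rewrite divr_gt0 ?exprn_gt0 ?pi_gt0.
have h1 := odd_sum4_rate N; have h2 := alt_sum3_rate N; have h3 := wtot_sum4_odd_sum4 N.
have h4 := normr_wtot_sum4 N.
rewrite -(ler_pM2r w0) -{1}(gtr0_norm w0) -normrM mulrBl.
have -> : 72 * zeta (3 : R) / pi ^+ 4 * (pi ^+ 4 / 96) = 3 / 4 * zeta (3 : R).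
  by move: (pi : R) (pi_gt0 R) => w ww; field; rewrite gt_eqF.
have -> : 1824 / pi ^+ 4 / N.+1%:R * (pi ^+ 4 / 96) =
    4 * (2 / N.+1%:R) + 8 / N.+1%:R + 3 / N.+1%:R :> R.
  have : N.+1%:R != 0 :> R by rewrite pnatr_eq0.
  by move: (N.+1%:R : R) (pi : R) (pi_gt0 R) => n w ww n0; field; rewrite n0 gt_eqF.
have -> : wtot_sum4 R N * (pi ^+ 4 / 96) - 3 / 4 * zeta (3 : R) =
   - (wtot_sum4 R N * (odd_sum4 N - pi ^+ 4 / 96)) + (wtot_sum4 R N * odd_sum4 N - alt_sum3 N)
   + (alt_sum3 N - 3 / 4 * zeta (3 : R)).
  ring.
apply: le_trans (ler_normD _ _) _; apply: lerD h2.
apply: le_trans (ler_normD _ _) _; apply: lerD h3.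
by rewrite normrN normrM ler_pM.
Qed.

End Rates.

(** * The asymptotic formula *)

Lemma N3_nsol r : N3 0 r = nsol r.
Proof.
rewrite /N3 -sum1dep_card big_mkcond /= /nsol /sum3.
rewrite pair_bigA pair_bigA /=; apply: eq_bigr => -[[x y] z] _ /=.
by rewrite /dvdn mod0n; case: eqP.
Qed.

(** The harmonic sum is at most [1 + ln x <= 2 ln x], whence [12 = 6 * 2]. Replacing [wtot_sum4] by
    its limit costs [x^3 / 3 * 1824 / (pi^4 x)], whence [608 = 1824 / 3]; likewise [24 = 72 / 3]. *)
Lemma sum_nsol_bound (R : realType) (x : R) : 1 <= ln x ->
  `|\sum_(1 <= r < (Num.truncn x).+1) (nsol r)%:R - 24 * zeta (3 : R) / pi ^+ 4 * x ^+ 3| <=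
  (12 + 608 / pi ^+ 4) * (x ^+ 2 * ln x).
Proof.
move=> lx; have x1 : 1 <= x.
  by rewrite leNgt; apply/negP => x1; have := ln_le0 (ltW x1); lra.
have x0 : 0 < x by lra.
have nx := truncn_itv (ltW x0); set n := Num.truncn x in nx *.
have n0 : (0 < n)%N by rewrite truncn_gt0.
have [h1 h2] := (sum_nsol_approx R n x nx, wtot_sum4_rate R n).
have h3 : \sum_(1 <= d < n.+1) d%:R^-1 <= 2 * ln x.
  apply: le_trans (harmonic_le_ln R n n0) _.
  have : ln n%:R <= ln x by case/andP: nx => nx _; rewrite ler_ln ?posrE ?ltr0n.
  by move: (ln n%:R : R) => l; lra.
have P0 : 0 < (pi ^+ 4)^-1 :> R by rewrite invr_gt0 exprn_gt0 // pi_gt0.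
set S := \sum_(1 <= r < n.+1) _ in h1 *.
set D := 72 * zeta (3 : R) / pi ^+ 4 in h2.
have -> : S - 24 * zeta (3 : R) / pi ^+ 4 * x ^+ 3 =
    (S - x ^+ 3 / 3 * wtot_sum4 R n) + x ^+ 3 / 3 * (wtot_sum4 R n - D).
  by rewrite /D; move: (pi ^+ 4)^-1 (zeta _) => P z; field.
apply: le_trans (ler_normD _ _) _; rewrite mulrDl; apply: lerD.
  apply: le_trans h1 _.
  have -> : 12 * (x ^+ 2 * ln x) = 6 * x ^+ 2 * (2 * ln x) by ring.
  by apply: ler_wpM2l h3; rewrite mulr_ge0 ?sqr_ge0.
have x30 : 0 < x ^+ 3 / 3 by rewrite divr_gt0 ?exprn_gt0.
rewrite normrM (gtr0_norm x30); apply: le_trans (_ : x ^+ 3 / 3 * (1824 / pi ^+ 4 / n.+1%:R) <= _).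
  by rewrite (ler_pM2l x30); exact: h2.
apply: le_trans (_ : x ^+ 3 / 3 * (1824 / pi ^+ 4 / x) <= _).
  have c0 : 0 < 1824 / pi ^+ 4 :> R by apply: mulr_gt0; rewrite ?ltr0n.
  rewrite (ler_pM2l x30) (ler_pM2l c0) lef_pV2 ?posrE ?ltr0n //.
  by case/andP: nx => _ /ltW.
have -> : x ^+ 3 / 3 * (1824 / pi ^+ 4 / x) = 608 / pi ^+ 4 * x ^+ 2.
  by move: (pi ^+ 4)^-1 => P; field; rewrite gt_eqF.
rewrite [leRHS]mulrA; apply: (ler_peMr _ lx); apply: mulr_ge0 (sqr_ge0 _).
by apply: mulr_ge0 (ltW P0); rewrite ler0n.
Qed.

Theorem proposition38 (R : realType) :
  (fun x : R => \sum_(1 <= r < (Num.truncn x).+1) (N3 0 r)%:R : R)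
  = (fun x : R => 24 * zeta (3 : R) / pi ^+ 4 * x ^+ 3)
    +O_ (+oo%R) (fun x : R => x ^+ 2 * ln x).
Proof.
apply/eqaddOP; exists (12 + 608 / pi ^+ 4); split; first exact: num_real.
(* Beyond [e] the logarithm is at least 1, as [sum_nsol_bound] requires. *)
move=> k /ltW hk; exists (expR 1); split; first exact: num_real.
move=> x /= ex; have lx : 1 <= ln x.
  by rewrite -[1](@expRK R) ler_ln ?posrE ?expR_gt0 ?(ltW ex) // (lt_trans (expR_gt0 1)).
rewrite !fctE; under eq_bigr => r _ do rewrite N3_nsol.
have g0 : 0 <= x ^+ 2 * ln x by rewrite mulr_ge0 ?sqr_ge0 // (le_trans ler01).
rewrite (ger0_norm g0); apply: le_trans (sum_nsol_bound R x lx) _.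
exact: ler_wpM2r.
Qed.
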